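(* Let $n\ge2$. For every adjacency matrix $A$ of a loopless undirected classical graph on $n$ vertices, $\omega(X_{A,\cdot})\le n-1$. If $A$ is the adjacency matrix of the complete classical graph on $n$ vertices (all off-diagonal entries $1$, zero diagonal), then $\omega(X_{A,\cdot})=n-1$.
   Context: $M_n=M_n(\mathbb C)$, with matrix units $E_{ij}$; ''projector'' means orthogonal projector. For a loopless undirected classical graph with adjacency matrix $A$, $X_{A,\cdot}$ is the quantum graph on $M_n$ with adjacency operator $x\mapsto\sum_{i,j}A_{ij}x_{jj}E_{ii}$; its operator space is $S=\operatorname{span}\{E_{ij}:A_{ij}=1\}\subseteq M_n$. A $k$-clique of a quantum graph with operator space $S$ is a projector $P\in M_n$ of rank $k$ such that $P(S\oplus\mathbb CI)P=PM_nP$; equivalently, an isometry $V\colon\mathbb C^k\to\mathbb C^n$ with $V^\dagger(S\oplus\mathbb CI)V=M_k$. The clique number $\omega$ of the quantum graph is the largest $k$ for which a $k$-clique exists. *)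

(* Defs.v *)
From HB Require Import structures.
From mathcomp Require Import all_boot all_order all_algebra.
From mathcomp Require Import boolp reals.
From mathcomp Require Export complex.

Set Implicit Arguments.
Unset Strict Implicit.
Unset Printing Implicit Defensive.

Import GRing.Theory Num.Theory.
Local Open Scope ring_scope.
Local Open Scope complex_scope.
Local Open Scope sesquilinear_scope.

Definition adjacency_matrix (R : realType) (n : nat) (A : 'M[R[i]]_n) : Prop :=
  [/\ forall i j, A i j = 0 \/ A i j = 1,
      forall i j, A i j = A j i
    & forall i, A i i = 0].

Definition complete_graph (R : realType) (n : nat) : 'M[R[i]]_n :=
  \matrix_(i, j) (i != j)%:R.

(* A quantum graph on M_n is given by its adjacency operator T : M_n -> M_n. *)
Definition classical_qgraph (R : realType) (n : nat) (A : 'M[R[i]]_n) (x : 'M[R[i]]_n) :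
    'M[R[i]]_n :=
  \sum_i \sum_j (A i j * x j j) *: delta_mx i i.

(* If T x = \sum_a K_a x K_a^*, then schur_mul T Y = \sum_a tr(K_a^* Y) K_a,
   because \sum_(k, l) E_kl Z E_lk = tr(Z) I. Its image is therefore the span
   of the Kraus operators K_a, which is the operator space of T. *)
Definition schur_mul (R : realType) (n : nat) (T : 'M[R[i]]_n -> 'M[R[i]]_n)
    (Y : 'M[R[i]]_n) : 'M[R[i]]_n :=
  \sum_k \sum_l T (delta_mx k l) *m Y *m delta_mx l k.

Definition operator_space (R : realType) (n : nat)
    (T : 'M[R[i]]_n -> 'M[R[i]]_n) : {vspace 'M[R[i]]_n} :=
  limg (linfun (schur_mul T)).

Definition is_projector (R : realType) (n : nat) (P : 'M[R[i]]_n) : Prop :=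
  P *m P = P /\ P ^t* = P.

Definition compression (R : realType) (n : nat) (P Y : 'M[R[i]]_n) :
    'M[R[i]]_n := P *m Y *m P.

Definition is_clique (R : realType) (n : nat) (T : 'M[R[i]]_n -> 'M[R[i]]_n)
    (k : nat) (P : 'M[R[i]]_n) : Prop :=
  [/\ is_projector P,
      \rank P = k
    & (linfun (compression P) @: (operator_space T + <[1%:M]>)
       = linfun (compression P) @: fullv)%VS].

(* The range k <= n is harmless, as the rank of P is at most n; see
   [clique_numberP]. *)
Definition clique_number (R : realType) (n : nat)
    (T : 'M[R[i]]_n -> 'M[R[i]]_n) : nat :=
  \max_(k < n.+1 | `[< exists P, is_clique T k P >]) k.

Fact schur_mul_linear (R : realType) (n : nat)
    (T : 'M[R[i]]_n -> 'M[R[i]]_n) : linear (schur_mul T).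
Proof.
move=> a Y Z; rewrite /schur_mul scaler_sumr -big_split; apply: eq_bigr => k _.
rewrite scaler_sumr -big_split; apply: eq_bigr => l _ /=.
by rewrite mulmxDr mulmxDl -scalemxAr -scalemxAl.
Qed.
HB.instance Definition _ (R : realType) (n : nat)
    (T : 'M[R[i]]_n -> 'M[R[i]]_n) :=
  GRing.isLinear.Build R[i] 'M[R[i]]_n 'M[R[i]]_n _ (schur_mul T)
    (schur_mul_linear T).

Fact compression_linear (R : realType) (n : nat) (P : 'M[R[i]]_n) :
  linear (compression P).
Proof.
by move=> a Y Z; rewrite /compression mulmxDr mulmxDl -scalemxAr -scalemxAl.
Qed.
HB.instance Definition _ (R : realType) (n : nat) (P : 'M[R[i]]_n) :=
  GRing.isLinear.Build R[i] 'M[R[i]]_n 'M[R[i]]_n _ (compression P)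
    (compression_linear P).

Lemma schur_mul_classical (R : realType) (n : nat) (A Y : 'M[R[i]]_n) :
  schur_mul (classical_qgraph A) Y = \matrix_(i, j) (A i j * Y i j).
Proof.
have TE k l : classical_qgraph A (delta_mx k l) =
    if k == l then \sum_i A i k *: delta_mx i i else 0.
  rewrite /classical_qgraph; case: (eqVneq k l) => [<-|kl]; last first.
    rewrite big1 // => i _; rewrite big1 // => j _; rewrite mxE.
    case: (eqVneq j k) => [->|_]; last by rewrite mulr0 scale0r.
    by rewrite (negPf kl) mulr0 scale0r.
  apply: eq_bigr => i _; rewrite (bigD1 k) //= big1 ?addr0.
    by rewrite mxE eqxx mulr1.
  by move=> j jk; rewrite mxE (negPf jk) mulr0 scale0r.
have -> : schur_mul (classical_qgraph A) Y =
    \sum_k \sum_i (A i k * Y i k) *: delta_mx i k.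
  apply: eq_bigr => k _; rewrite (bigD1 k) //= big1 ?addr0; last first.
    by move=> l lk; rewrite TE eq_sym (negPf lk) !mul0mx.
  rewrite TE eqxx !mulmx_suml; apply: eq_bigr => i _.
  rewrite -!scalemxAl -scalerA; congr (_ *: _).
  apply/matrixP => a b; rewrite !mxE (bigD1 k) //= big1 ?addr0; last first.
    by move=> c ck; rewrite [delta_mx k k c b]mxE (negPf ck) mulr0.
  rewrite mxE (bigD1 i) //= big1 ?addr0; last first.
    by move=> c ci; rewrite mxE (negPf ci) andbF mul0r.
  by rewrite !mxE !eqxx andbT /=; case: (a == i); case: (b == k);
    rewrite ?mul1r ?mulr1 ?mul0r ?mulr0.
rewrite exchange_big /= [RHS]matrix_sum_delta.
by apply: eq_bigr => i _; apply: eq_bigr => k _; rewrite mxE.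
Qed.

Lemma operator_space_classical (R : realType) (n : nat) (A : 'M[R[i]]_n) :
  adjacency_matrix A ->
  operator_space (classical_qgraph A) =
    span [seq delta_mx p.1 p.2 | p <- enum {: 'I_n * 'I_n} & A p.1 p.2 == 1].
Proof.
case=> A01 _ _; apply/eqP; rewrite eqEsubv; apply/andP; split.
  apply/subvP => Z /memv_imgP [Y _ ->]; rewrite lfunE /= schur_mul_classical.
  rewrite (matrix_sum_delta (\matrix_(i, j) _)).
  apply: memv_suml => i _; apply: memv_suml => j _; rewrite mxE.
  case: (A01 i j) => Aij; rewrite Aij ?mul0r ?scale0r ?mem0v //.
  apply/memvZ/memv_span/mapP; exists (i, j) => //.
  by rewrite mem_filter /= Aij eqxx /= mem_enum.
apply/span_subvP => Z /mapP [[i j]].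
rewrite mem_filter /= => /andP [/eqP Aij _] ->.
apply/memv_imgP; exists (delta_mx i j); first exact: memvf.
rewrite lfunE /= schur_mul_classical; apply/matrixP => a b; rewrite !mxE.
case: (eqVneq a i) => [->|_] /=; last by rewrite mulr0.
by case: (eqVneq b j) => [->|_] /=; rewrite ?Aij ?mulr1 ?mulr0.
Qed.

Lemma clique_numberP (R : realType) (n : nat) (T : 'M[R[i]]_n -> 'M[R[i]]_n) :
  (exists P, is_clique T (clique_number T) P) /\
  (forall k P, is_clique T k P -> (k <= clique_number T)%N).
Proof.
split=> [|k P cP].
  have H0 : `[< exists P, is_clique T (@ord0 n) P >].
    apply/asboolP; exists 0; split; rewrite ?mxrank0 //.
      by split; rewrite ?mulmx0 // trmx0 map_mx0.
    have -> : linfun (compression (0 : 'M[R[i]]_n)) = 0%R.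
      by apply/lfunP => Y; rewrite lfunE /= zero_lfunE /compression mulmx0.
    by rewrite !lim0g.
  by rewrite /clique_number (bigmax_eq_arg _ H0); case: arg_maxnP => // k /asboolP.
have kn : (k < n.+1)%N by case: cP => _ <- _; rewrite ltnS rank_leq_row.
apply: (leq_bigmax_cond (Ordinal kn)).
by apply/asboolP; exists P.
Qed.

(* Main.v *)
(** For the upper bound, a projector of rank [n] is the identity, and the span
    of the operator space and the identity contains only matrices with constant
    diagonal. For the complete graph, the projector [P] onto the orthogonal
    complement of the all-ones vector [e] has rank [n - 1], and compression by
    [P] kills [u e^T] for every [u]; subtracting [u e^T] with [u] the diagonal
    of [Y] moves [Y] into the operator space without changing [P Y P]. *)
Require Import Defs.
From mathcomp Require Import all_boot all_order all_algebra reals.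

Local Open Scope ring_scope.
Local Open Scope complex_scope.

Set Implicit Arguments.
Unset Strict Implicit.
Unset Printing Implicit Defensive.

Import GRing.Theory Num.Theory.

(** Schur multiplication by [A] kills the diagonal, so only the multiple of the identity contributes
    to it. *)
Lemma diag_operator_space (R : realType) (n : nat) (A : 'M[R[i]]_n)
    (Z : 'M[R[i]]_n) :
  adjacency_matrix A ->
  Z \in (operator_space (classical_qgraph A) + <[1%:M]>)%VS ->
  forall i j, Z i i = Z j j.
Proof.
case=> _ _ A0 /memv_addP [_ /memv_imgP [Y _ ->]] [_ /vlineP [c ->] ->] i j.
by rewrite lfunE /= schur_mul_classical !mxE !A0 !mul0r !eqxx.
Qed.

Lemma complete_graph_adjacency (R : realType) (n : nat) :
  adjacency_matrix (complete_graph R n).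
Proof.
split=> [i j|i j|i]; rewrite !mxE ?eqxx //.
- by case: (i != j); [right|left].
- by rewrite eq_sym.
Qed.

(** Schur multiplication by the complete graph fixes such a [Z], which is thus its own preimage. *)
Lemma mem_operator_space_complete (R : realType) (n : nat) (Z : 'M[R[i]]_n) :
  (forall i, Z i i = 0) ->
  Z \in operator_space (classical_qgraph (complete_graph R n)).
Proof.
move=> Z0; apply/memv_imgP; exists Z; rewrite ?memvf // lfunE /=.
rewrite schur_mul_classical; apply/matrixP => i j; rewrite !mxE.
by case: eqVneq => [->|_]; rewrite ?Z0 ?mulr0 ?mul1r.
Qed.

Lemma clique_number_classical_le (R : realType) (n : nat) (A : 'M[R[i]]_n) :
  (2 <= n)%N -> adjacency_matrix A ->
  (clique_number (classical_qgraph A) <= n - 1)%N.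
Proof.
move=> n_ge2 adjA; have n_gt0 := ltnW n_ge2.
have [[P [[PP _] rP imP]] _] := clique_numberP (classical_qgraph A).
rewrite -ltnS subn1 prednK // ltnNge -rP; apply/negP => n_le_rP.
have Pu : P \in unitmx.
  by rewrite -row_free_unit /row_free eqn_leq rank_leq_row.
have P1 : P = 1%:M by rewrite -[P](mulmxK Pu) PP mulmxV.
have comp1 : linfun (compression P) = \1%VF.
  by apply/lfunP => Y; rewrite !lfunE /= /compression P1 mulmx1 mul1mx.
move: imP; rewrite comp1 !lim1g => full.
(* With two distinct indices available, a diagonal matrix unit has both 1 and 0 on its diagonal. *)
pose i0 := Ordinal n_gt0; pose i1 := Ordinal n_ge2.
have : delta_mx i0 i0
    \in (operator_space (classical_qgraph A) + <[1%:M]>)%VS.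
  by rewrite full memvf.
move=> /(diag_operator_space adjA) /(_ i0 i1) /eqP.
by rewrite !mxE oner_eq0.
Qed.

Definition ones_complement (R : realType) (n : nat) : 'M[R[i]]_n :=
  1%:M - n%:R^-1 *: const_mx 1.

Section OnesComplement.
Variables (R : realType) (n : nat).
Hypothesis n_gt0 : (0 < n)%N.
Let P := ones_complement R n.

(** Every row is [e^T], and [e^T e = n]. The case [m = n] gives idempotence of [P]; [m = 1] serves
    the compression. *)
Lemma ones_mul_complement m : (const_mx 1 : 'M[R[i]]_(m, n)) *m P = 0.
Proof.
rewrite /P /ones_complement mulmxBr mulmx1 -scalemxAr.
apply/matrixP => i j; rewrite !mxE.
under eq_bigr do rewrite !mxE mul1r.
by rewrite sumr_const card_ord mulVf ?subrr // pnatr_eq0 -lt0n.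
Qed.

Lemma ones_complement_projector : is_projector P.
Proof.
split.
  by rewrite {1}/P /ones_complement mulmxBl mul1mx -scalemxAl
    ones_mul_complement scaler0 subr0.
apply/matrixP => i j; rewrite !mxE rmorphB rmorphM rmorph1 fmorphV /=.
by rewrite !conjC_nat eq_sym.
Qed.

(** The identity is [P] plus a matrix of rank at most one, and rank is subadditive. *)
Lemma ones_complement_rank : (n - 1 <= \rank P)%N.
Proof.
rewrite leq_subLR -{1}(mxrank1 R[i] n).
have -> : 1%:M = n%:R^-1 *: const_mx 1 + P :> 'M[R[i]]_n.
  by rewrite addrC subrK.
apply: leq_trans (mxrank_add _ _) _; rewrite leq_add2r.
have -> : const_mx 1 = (const_mx 1 : 'cV[R[i]]_n) *m (const_mx 1 : 'rV_n).
  by apply/matrixP => i j; rewrite !mxE big_ord1 !mxE mul1r.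
by rewrite scalemxAl (leq_trans (mxrankM_maxl _ _)) ?rank_leq_col.
Qed.

(** The size is left as [\rank P]: its lower bound, together with the general upper bound on
    cliques, settles the clique number. *)
Lemma ones_complement_clique :
  is_clique (classical_qgraph (complete_graph R n)) (\rank P) P.
Proof.
split=> //; first exact: ones_complement_projector.
apply/eqP; rewrite eqEsubv limgS ?subvf //=.
apply/subvP => _ /memv_imgP [Y _ ->].
pose U := (\col_i Y i i) *m (const_mx 1 : 'rV[R[i]]_n).
have -> : linfun (compression P) Y = linfun (compression P) (Y - U).
  rewrite linearB /= [in X in _ = _ - X]lfunE /= /compression /U.
  by rewrite -!mulmxA ones_mul_complement !mulmx0 subr0.
apply/memv_img/(subvP (addvSl _ _))/mem_operator_space_complete => i.
by rewrite !mxE big_ord1 !mxE mulr1 subrr.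
Qed.

End OnesComplement.

Theorem proposition4p44 (R : realType) (n : nat) (n_ge2 : (2 <= n)%N) :
  (forall A : 'M[R[i]]_n,
     adjacency_matrix A -> (clique_number (classical_qgraph A) <= n - 1)%N) /\
  clique_number (classical_qgraph (complete_graph R n)) = (n - 1)%N.
Proof.
have ub A := @clique_number_classical_le R n A n_ge2.
split=> //; apply/eqP; rewrite eqn_leq.
rewrite (ub _ (@complete_graph_adjacency R n)) /=.
have [_ lb] := clique_numberP (classical_qgraph (complete_graph R n)).
apply: leq_trans (ones_complement_rank R n) _.
exact/lb/ones_complement_clique/ltnW.
Qed.
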